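(* Let $E$ be a commutative Noetherian ring in which linear equations are solvable, $I=\langle\nu_1,\ldots,\nu_s\rangle$ a proper ideal of $E[y_1,\ldots,y_m]$, $R=E[y_1,\ldots,y_m]/I$, $A=R[x_1,\ldots,x_n]$, $T=E[y_1,\ldots,y_m,x_1,\ldots,x_n]$, and $Q=(E[y_1,\ldots,y_m])[x_1,\ldots,x_n]$ (so $T=Q$ as rings). Let $$\varphi:Q\to A,\qquad \sum_ih_ix^{\alpha(i)}\mapsto\sum_i\overline h_ix^{\alpha(i)},\quad \overline h=h+I,$$ be the canonical ring epimorphism. Let $\overline J=\langle\overline f_1,\ldots,\overline f_t\rangle$ be an ideal of $A$, where $\overline f_i=\sum_j\overline h_{ij}x^{\alpha(j)}$ are nonzero polynomials written with nonzero coefficients $\overline h_{ij}$ represented by $h_{ij}\in E[y_1,\ldots,y_m]$. Put $f_i=\sum_jh_{ij}x^{\alpha(j)}$, $S=\{f_1,\ldots,f_t,\nu_1,\ldots,\nu_s\}$ and let $J=\langle S\rangle$ be the ideal of $T$ generated by $S$. Let $\prec$ be an elimination ordering on the monomials of $T$ with the $x$ variables larger than the $y$ variables, and suppose that $G=\{\nu_1,\ldots,\nu_s\}$ is a Gröbner basis of $I$ in $E[y_1,\ldots,y_m]$ with respect to the restriction of $\prec$ to $y$-monomials. Let $\mathcal G=\{g_1,\ldots,g_l\}$ be a Gröbner basis of $J$ in $T$ with respect to $\prec$ constructed by the Gröbner basis algorithm (recalled in the context) with initial input $S$. Then: (i) For each $g_i\in\mathcal G$ with $g_i\notin G$, $\mathbf{LT}_x(\varphi(g_i))=\varphi(\mathbf{LT}_x(g_i))$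 and hence $\mathbf{LM}_x(\varphi(g_i))=\mathbf{LM}_x(g_i)$. (ii) The set $$\overline{\mathcal G}=\{\overline g_k=\varphi(g_k)\mid g_k\in\mathcal G,\ g_k\ne\nu_j,\ 1\le j\le s\}=\varphi(\mathcal G)-\{0\}$$ is a Gröbner basis for $\overline J$ in $A$ with respect to the restriction of $\prec$ to $x$-monomials. (iii) Each $g_k\in\mathcal G-\{\nu_1,\ldots,\nu_s\}$, as an element of $Q$, has a representation $g_k=g_k'+g_k''$ with $g_k'=\sum_qh_{kq}x^{\alpha(q)}$, $h_{kq}\notin I$ for all $q$, and $g_k''=\sum_\ell h_{k\ell}x^{\alpha(\ell)}$, $h_{k\ell}\in I$ for all $\ell$, and such a representation can be algorithmically determined. Hence each element of $\overline{\mathcal G}$ has a representation $\overline g_k=\varphi(g_k)=\varphi(g_k')=\sum_q\overline h_{kq}x^{\alpha(q)}$ with all $\overline h_{kq}\neq0$.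
   Context: Linear equations are solvable in a commutative Noetherian ring $E$ if there are algorithms (1) deciding, for $\lambda,\lambda_1,\ldots,\lambda_k\in E$, whether $\lambda\in\langle\lambda_1,\ldots,\lambda_k\rangle$ and in that case computing $\mu_i$ with $\lambda=\sum\lambda_i\mu_i$, and (2) computing generators of the syzygy module $\{(\mu_i)\in E^k\mid\sum\lambda_i\mu_i=0\}$. Ordering: $\prec$ is a monomial ordering on the monomials $x^\alpha y^\beta$ of $T$ with $x^\alpha y^\beta\prec x^{\alpha'}y^{\beta'}$ iff $x^\alpha\prec x^{\alpha'}$, or $x^\alpha=x^{\alpha'}$ and $y^\beta\prec y^{\beta'}$; its restrictions to $x$-monomials and to $y$-monomials are also denoted $\prec$. Leading data: for a polynomial ring over a commutative ring with a monomial ordering and a nonzero polynomial $f$ written with nonzero coefficients, $\mathbf{LM}(f)$ is its largest monomial, $\mathbf{LC}(f)$ the coefficient of $\mathbf{LM}(f)$, $\mathbf{LT}(f)=\mathbf{LC}(f)\mathbf{LM}(f)$. For elements of $T$ (coefficients in $E$, monomials $x^\alpha y^\beta$) we write $\mathbf{LM},\mathbf{LT}$; for elements of $Q$ (coefficients in $E[y_1,\ldots,y_m]$, monomials $x^\alpha$) and of $A$ (coefficients in $R$, monomials $x^\alpha$) we write $\mathbf{LM}_x,\mathbf{LT}_x$. Gröbner basis: a finite set $\mathcal G$ of nonzero elements of an ideal $J$ of a polynomial ring over a commutative Noetherian ring is a Gröbner basis of $J$ if $\langle\mathbf{LT}(J)\rangle=\langle\mathbf{LT}(\mathcal G)\rangle$.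 Reduction: $f\ne0$ reduces in one step modulo a finite set $F$ of nonzero polynomials of $T$ to $f-\sum_j\lambda_ju_jf_{i_j}$ if $f_{i_j}\in F$, $\lambda_j\in E-\{0\}$, $u_j$ are monomials, $\mathbf{LM}(f)=u_j\mathbf{LM}(f_{i_j})$ for all $j$, and $\mathbf{LT}(f)=\sum_j\lambda_ju_j\mathbf{LT}(f_{i_j})$; $f\neq 0$ is minimal with respect to $F$ if no such step exists. Gröbner basis algorithm with input a finite set $S$ of nonzero polynomials of $T$ (zero elements discarded): start with $H:=\emptyset$, $H':=S$. While $H'\ne H$: set $H:=H'=\{p_1,\ldots,p_k\}$; compute a finite homogeneous generating set $B$ of $\mathrm{Syz}_T(\mathbf{LT}(p_1),\ldots,\mathbf{LT}(p_k))$; for each $(h_1,\ldots,h_k)\in B$ reduce $\sum h_ip_i$ modulo the current $H'$ to some $r$ that is $0$ or minimal with respect to $H'$, and if $r\neq0$ replace $H'$ by $H'\cup\{r\}$. The output is $H$, a Gröbner basis of $\langle S\rangle$. *)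

(* Defs.v *)
From HB Require Import structures.
From mathcomp Require Import all_boot all_order all_algebra.
From mathcomp Require Import ring_quotient.
From mathcomp Require Export mpoly.
From Stdlib Require Export Relation_Operators.

Set Implicit Arguments.
Unset Strict Implicit.
Unset Printing Implicit Defensive.

Import GRing.Theory.
Local Open Scope ring_scope.

(* The ideal generated by an arbitrary (possibly infinite) subset P. *)
Definition ideal_gen (K : comNzRingType) (P : K -> Prop) (f : K) : Prop :=
  exists2 s : seq (K * K),
    (forall p, p \in s -> P p.2) & f = \sum_(p <- s) p.1 * p.2.

Definition is_ideal (K : comNzRingType) (P : K -> Prop) : Prop :=
  [/\ P 0, forall a b, P a -> P b -> P (a + b) & forall a b, P b -> P (a * b)].

Definition noetherian (K : comNzRingType) : Prop :=
  forall P : K -> Prop, is_ideal P ->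
    exists F : seq K, forall a, P a <-> ideal_gen (fun x => x \in F) a.

Definition dot (K : comNzRingType) k (l v : 'rV[K]_k) : K :=
  \sum_(i < k) l 0 i * v 0 i.

Definition generates_syz (K : comNzRingType) k (l : 'rV[K]_k)
    (B : seq 'rV[K]_k) : Prop :=
  forall v : 'rV[K]_k, dot l v = 0 <->
    exists c : 'I_(size B) -> K, v = \sum_j c j *: B`_j.

(* "Linear equations are solvable in E": the algorithms are data, so that
   other algorithms can call them. *)
Record lin_solver (E : comNzRingType) : Type := LinSolver {
  ls_mem : forall k, E -> 'rV[E]_k -> option 'rV[E]_k;
  ls_syz : forall k, 'rV[E]_k -> seq 'rV[E]_k;
  ls_memP : forall k (a : E) (l : 'rV[E]_k),
    match ls_mem a l with
    | Some v => a = dot l v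
    | None => forall v : 'rV[E]_k, a <> dot l v
    end;
  ls_syzP : forall k (l : 'rV[E]_k), generates_syz l (ls_syz l)
}.

(* A monomial ordering is given by its strict relation; 0%MM is the exponent
   of the monomial 1, and + on exponents is the product of monomials. *)
Definition monomial_order N (lt : rel 'X_{1..N}) : Prop :=
  [/\ irreflexive lt, transitive lt,
      forall u v, u != v -> lt u v || lt v u,
      forall u, u != 0%MM -> lt 0%MM u
    & forall u v w, lt u v -> lt (u + w)%MM (v + w)%MM].

(* The exponent of x^b y^a in E[y_1, ..., y_m, x_1, ..., x_n]. *)
Definition mcat m n (a : 'X_{1..m}) (b : 'X_{1..n}) : 'X_{1..m + n} :=
  [multinom match split i with inl j => a j | inr k => b k end | i < m + n].

Definition restr_y m n (lt : rel 'X_{1..m + n}) : rel 'X_{1..m} :=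
  fun a a' => lt (mcat a 0%MM) (mcat a' 0%MM).

Definition restr_x m n (lt : rel 'X_{1..m + n}) : rel 'X_{1..n} :=
  fun b b' => lt (mcat 0%MM b) (mcat 0%MM b').

Definition elimination_order m n (lt : rel 'X_{1..m + n}) : Prop :=
  monomial_order lt /\
  forall (a a' : 'X_{1..m}) (b b' : 'X_{1..n}),
    lt (mcat a b) (mcat a' b') =
    restr_x lt b b' || (b == b') && restr_y lt a a'.

(* The default 0%MM is harmless for f != 0, being the least monomial.  For the
   zero polynomial these give LM = 0%MM, LC = 0 and LT = 0. *)
Definition LM N (K : comNzRingType) (lt : rel 'X_{1..N}) (f : {mpoly K[N]}) :
    'X_{1..N} :=
  foldr (fun u acc => if lt acc u then u else acc) 0%MM (msupp f).

Definition LC N (K : comNzRingType) (lt : rel 'X_{1..N}) (f : {mpoly K[N]}) : K :=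
  f@_(LM lt f).

Definition LT N (K : comNzRingType) (lt : rel 'X_{1..N}) (f : {mpoly K[N]}) :
    {mpoly K[N]} :=
  LC lt f *: 'X_[LM lt f].

Definition LT_set N (K : comNzRingType) (lt : rel 'X_{1..N})
    (P : {mpoly K[N]} -> Prop) (t : {mpoly K[N]}) : Prop :=
  exists f, [/\ P f, f != 0 & t = LT lt f].

Definition is_grobner N (K : comNzRingType) (lt : rel 'X_{1..N})
    (J : {mpoly K[N]} -> Prop) (G : seq {mpoly K[N]}) : Prop :=
  (forall g, g \in G -> g != 0 /\ J g) /\
  (forall f, ideal_gen (LT_set lt J) f <->
             ideal_gen (LT_set lt (fun g => g \in G)) f).

(* One step of reduction; an entry (c, u, p) of s contributes c u p. *)
Definition reduces1 N (K : comNzRingType) (lt : rel 'X_{1..N})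
    (F : seq {mpoly K[N]}) (f f' : {mpoly K[N]}) : Prop :=
  f != 0 /\
  exists s : seq (K * 'X_{1..N} * {mpoly K[N]}),
    [/\ forall c u p, (c, u, p) \in s ->
          [/\ p \in F, c != 0 & LM lt f = (u + LM lt p)%MM],
        LT lt f = \sum_(q <- s) q.1.1 *: ('X_[q.1.2] * LT lt q.2)
      & f' = f - \sum_(q <- s) q.1.1 *: ('X_[q.1.2] * q.2)].

Definition minimal_wrt N (K : comNzRingType) (lt : rel 'X_{1..N})
    (F : seq {mpoly K[N]}) (f : {mpoly K[N]}) : Prop :=
  f != 0 /\ ~ exists f', reduces1 lt F f f'.

Definition reduces N (K : comNzRingType) (lt : rel 'X_{1..N})
    (F : seq {mpoly K[N]}) : {mpoly K[N]} -> {mpoly K[N]} -> Prop :=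
  clos_refl_trans _ (reduces1 lt F).

(* The Groebner basis algorithm involves choices (of the syzygies and of the
   reductions), so it is a relation between input and output. *)

Definition LT_row N (K : comNzRingType) (lt : rel 'X_{1..N})
    (H : seq {mpoly K[N]}) : 'rV[{mpoly K[N]}]_(size H) :=
  \row_(i < size H) LT lt H`_i.

(* h is homogeneous of degree X: each nonzero entry is a term c u with
   u LM(p_i) = X. *)
Definition homogeneous_syz N (K : comNzRingType) (lt : rel 'X_{1..N})
    (H : seq {mpoly K[N]}) (h : 'rV[{mpoly K[N]}]_(size H)) : Prop :=
  dot (LT_row lt H) h = 0 /\
  exists X : 'X_{1..N}, forall i : 'I_(size H), h 0 i != 0 ->
    exists (c : K) (u : 'X_{1..N}),
      h 0 i = c *: 'X_[u] /\ (u + LM lt H`_i)%MM = X.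

Definition syz_comb N (K : comNzRingType) (H : seq {mpoly K[N]})
    (h : 'rV[{mpoly K[N]}]_(size H)) : {mpoly K[N]} :=
  \sum_(i < size H) h 0 i * H`_i.

(* gb_pass lt B H1 H2: processing the elements of B in turn transforms the
   current H' from H1 to H2. *)
Inductive gb_pass N (K : comNzRingType) (lt : rel 'X_{1..N})
    (H : seq {mpoly K[N]}) :
    seq 'rV[{mpoly K[N]}]_(size H) ->
    seq {mpoly K[N]} -> seq {mpoly K[N]} -> Prop :=
| gb_pass_nil H1 : gb_pass lt [::] H1 H1
| gb_pass_zero h B H1 H2 :
    reduces lt H1 (syz_comb h) 0 ->
    gb_pass lt B H1 H2 -> gb_pass lt (h :: B) H1 H2
| gb_pass_add h B r H1 H2 :
    reduces lt H1 (syz_comb h) r -> minimal_wrt lt H1 r ->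
    gb_pass lt B (rcons H1 r) H2 -> gb_pass lt (h :: B) H1 H2.

(* gb_loop lt H H' out: the while loop, entered in the state (H, H'),
   terminates with output out. *)
Inductive gb_loop N (K : comNzRingType) (lt : rel 'X_{1..N}) :
    seq {mpoly K[N]} -> seq {mpoly K[N]} -> seq {mpoly K[N]} -> Prop :=
| gb_loop_exit H H' : H' =i H -> gb_loop lt H H' H
| gb_loop_iter H H' H'' B out :
    ~ (H' =i H) ->
    generates_syz (LT_row lt H') B ->
    (forall h, h \in B -> homogeneous_syz lt h) ->
    gb_pass lt B H' H'' ->
    gb_loop lt H' H'' out -> gb_loop lt H H' out.

Definition gb_algorithm N (K : comNzRingType) (lt : rel 'X_{1..N})
    (S out : seq {mpoly K[N]}) : Prop :=
  gb_loop lt [::] (undup [seq f <- S | f != 0]) out.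

(* T = {mpoly E[m + n]}, with the m variables y first, is identified with
   Q = {mpoly {mpoly E[m]}[n]} by the mutually inverse ring isomorphisms toQ
   and toT; yT is the inclusion of E[y_1, ..., y_m] in T. *)

Definition yT (E : comNzRingType) m n (p : {mpoly E[m]}) : {mpoly E[m + n]} :=
  mmap (@mpolyC (m + n) E) (fun j : 'I_m => 'X_(lshift n j)) p.

Definition toT (E : comNzRingType) m n (f : {mpoly {mpoly E[m]}[n]}) :
    {mpoly E[m + n]} :=
  mmap (@yT E m n) (fun k : 'I_n => 'X_(rshift m k)) f.

Definition toQ (E : comNzRingType) m n (f : {mpoly E[m + n]}) :
    {mpoly {mpoly E[m]}[n]} :=
  mmap (fun c : E => (c%:MP)%:MP)
       (fun i : 'I_(m + n) =>
          match split i with inl j => ('X_j)%:MP | inr k => 'X_k end) f.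

Definition phi (E : comNzRingType) m n (I : idealr {mpoly E[m]})
    (f : {mpoly {mpoly E[m]}[n]}) : {mpoly {ideal_quot I}[n]} :=
  map_mpoly (\pi_({ideal_quot I})%qT : {mpoly E[m]} -> {ideal_quot I}) f.

(* The polynomial with the support of f and the coefficients h. *)
Definition lift_coefs (K K' : comNzRingType) n (f : {mpoly K[n]})
    (h : 'X_{1..n} -> K') : {mpoly K'[n]} :=
  \sum_(u <- msupp f) h u *: 'X_[u].

(* The remaining functions are an explicit algorithm, calling only the ring
   operations, the equality test and the solver of E, and the ordering.
   The fuel bounds the number of reduction steps, with None when it is
   exhausted, so that termination is not built into the definition. *)

Definition reduce_step (E : comNzRingType) N (ls : lin_solver E)
    (lt : rel 'X_{1..N}) (F : seq {mpoly E[N]}) (f : {mpoly E[N]}) :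
    option {mpoly E[N]} :=
  let D := [seq p <- F | (LM lt p <= LM lt f)%MM] in
  if ls_mem ls (LC lt f) (\row_(i < size D) LC lt D`_i) is Some v then
    Some (f - \sum_(i < size D)
                v 0 i *: ('X_[(LM lt f - LM lt D`_i)%MM] * D`_i))
  else None.

(* Membership of f in the ideal generated by the Groebner basis F. *)
Fixpoint grobner_mem (E : comNzRingType) N (ls : lin_solver E)
    (lt : rel 'X_{1..N}) (F : seq {mpoly E[N]}) (fuel : nat) (f : {mpoly E[N]}) :
    option bool :=
  if f == 0 then Some true else
  if fuel is fuel'.+1 then
    if reduce_step ls lt F f is Some f' then grobner_mem ls lt F fuel' f'
    else Some false
  else None.

(* Sorts the terms h x^u of g into those with h not in <F> and those with h in
   <F>, and returns the pair of the two partial sums. *)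
Definition split_coefs (E : comNzRingType) m n (ls : lin_solver E)
    (lt : rel 'X_{1..m}) (F : seq {mpoly E[m]}) (fuel : nat)
    (g : {mpoly {mpoly E[m]}[n]}) :
    option ({mpoly {mpoly E[m]}[n]} * {mpoly {mpoly E[m]}[n]}) :=
  foldr (fun u acc =>
    match acc, grobner_mem ls lt F fuel g@_u with
    | Some (g1, g2), Some true => Some (g1, g2 + g@_u *: 'X_[u])
    | Some (g1, g2), Some false => Some (g1 + g@_u *: 'X_[u], g2)
    | _, _ => None
    end) (Some (0, 0)) (msupp g).

(* Main.v *)
(* Parts (i) and (ii) rest on this: for g in the output but not in G, the
   x-leading coefficient of g is not in I.
   For f_i this is how the representatives are chosen; any other g outside G was
   added as a minimal element with respect to a set containing G, and since G is
   a Groebner basis of I, an x-leading coefficient in I would make LT(g)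
   reducible by G.  For (ii), an element of Jbar is lifted to some f in J with no
   coefficient in I; a Groebner basis for an elimination ordering is also one
   over E[y], so LT_x(f) lies in the ideal of the LT_x(g), and phi carries this
   to A.  For (iii), reduction modulo nu decides membership in I, and it
   terminates because monomial orderings are well-founded. *)

Require Import Defs.
From HB Require Import structures.
From mathcomp Require Import all_boot all_order all_algebra.
From mathcomp Require Import ring_quotient.
From Stdlib Require Import Classical.
From Stdlib Require IndefiniteDescription.

Set Implicit Arguments.
Unset Strict Implicit.
Unset Printing Implicit Defensive.

Import GRing.Theory.
Local Open Scope ring_scope.

(** * Dickson's lemma and well-foundedness of monomial orderings *)

Lemma nat_seq_tail_minimum (a : nat -> nat) (i : nat) :
  exists j, (i <= j)%N /\ forall k, (i <= k)%N -> (a j <= a k)%N.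
Proof.
(* Induction on a bound [b] for the value at [j]: either a later index has a value below the bound,
   or [j] already attains the minimum. *)
suff H b j : (i <= j)%N -> (a j <= b)%N ->
    exists j', (i <= j')%N /\ forall k, (i <= k)%N -> (a j' <= a k)%N.
  exact: H (leqnn i) (leqnn _).
elim: b j => [|b IHb] j ij.
  by rewrite leqn0 => /eqP aj0; exists j; split=> // k _; rewrite aj0.
move=> ajb; case: (classic (exists2 k, i <= k & a k <= b)%N) => [[k ik akb]|nex].
  exact: IHb akb.
exists j; split=> // k ik; apply: leq_trans ajb _; rewrite ltnNge.
by apply/negP => akb; apply: nex; exists k.
Qed.

(** Choose repeatedly an index minimising [a] on the tail strictly after the previous choice. Each
    tail contains all later choices, so the chosen values cannot decrease. *)
Lemma nat_seq_monotone_subseq (a : nat -> nat) :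
  exists2 s : nat -> nat,
    {homo s : i j / (i < j)%N} & {homo a \o s : i j / (i <= j)%N}.
Proof.
have [g gP] := IndefiniteDescription.functional_choice _ (nat_seq_tail_minimum a).
pose s := fix s k := if k is k'.+1 then g (s k').+1 else g 0%N.
have s_lt k : (s k < s k.+1)%N by have [] := gP (s k).+1.
have min k l : (s k <= l)%N -> (a (s k) <= a l)%N.
  by case: k => [|k]; [move=> _; apply: (gP 0%N).2|
    move=> sl; apply: (gP (s k).+1).2; apply: leq_trans (s_lt k) sl].
exists s; first by apply: homo_ltn => //; exact: ltn_trans.
apply: homo_leq => [//|y x z|k /=]; first exact: leq_trans.
exact/min/ltnW.
Qed.

(** Pass to subsequences that make one more coordinate monotone each time. Once all [N] are
    monotone, the first two terms of the subsequence serve. *)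
Lemma dickson N (u : nat -> 'X_{1..N}) :
  exists i j, (i < j)%N /\ (u i <= u j)%MM.
Proof.
suff H k : exists2 s : nat -> nat, {homo s : i j / (i < j)%N} &
    forall c : 'I_N, (c < k)%N -> {homo (fun i => u (s i) c) : i j / (i <= j)%N}.
  have [s s_lt mon] := H N.
  exists (s 0%N), (s 1%N); split; first exact: s_lt.
  by apply/mnm_lepP => c; apply: mon.
elim: k => [|k [s s_lt mon]]; first by exists id.
have [kN|Nk] := ltnP k N; last first.
  exists s => // c ck; apply: mon; apply: leq_trans (ltn_ord c) Nk.
have [s' s'_lt mon'] := nat_seq_monotone_subseq (fun i => u (s i) (Ordinal kN)).
exists (s \o s') => [i j ij|c]; first exact/s_lt/s'_lt.
rewrite ltnS leq_eqVlt => /orP[/eqP ck|ck] i j ij /=.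
  by rewrite (_ : c = Ordinal kN); [exact: mon' | exact: val_inj].
by apply: mon => //; case: ltngtP ij => // [/s'_lt/ltnW|->].
Qed.

Section MonomialOrder.
Variables (N : nat) (lt : rel 'X_{1..N}) (hlt : monomial_order lt).

Lemma mo_irr u : lt u u = false. Proof. by case: hlt => irr *; exact: irr. Qed.
Lemma mo_trans : transitive lt. Proof. by case: hlt. Qed.
Lemma mo_total u v : [|| u == v, lt u v | lt v u].
Proof. by have [//|uv] := eqVneq; case: hlt => _ _ tot *; apply: tot. Qed.
Lemma mo_asym u v : lt u v -> lt v u = false.
Proof.
by move=> uv; apply/negP => vu; have := mo_trans uv vu; rewrite mo_irr.
Qed.
Lemma mo_add2r w u v : lt (u + w)%MM (v + w)%MM = lt u v.
Proof.
case: (hlt) => _ _ _ _ add; have [uv|vu] := boolP (lt u v); first exact: add.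
have := mo_total u v; rewrite (negPf vu) => /orP[/eqP ->|vu']; first by rewrite mo_irr.
by rewrite (mo_asym (add _ _ w vu')).
Qed.
Lemma mo_add2l w u v : lt (w + u)%MM (w + v)%MM = lt u v.
Proof. by rewrite ![(w + _)%MM]addmC mo_add2r. Qed.

Lemma mo_lem u v : (u <= v)%MM -> lt v u = false.
Proof.
move=> /submK <-; rewrite -{3}[u]add0m mo_add2r.
have [->|nz] := eqVneq (v - u)%MM 0%MM; first exact: mo_irr.
by case: (hlt) => _ _ _ pos _; apply: mo_asym; apply: pos.
Qed.

(** A non-accessible monomial starts, by choice, an infinite strictly descending sequence. Dickson's
    lemma finds in it a term dividing a later one, and a monomial is never above its multiples. *)
Lemma mo_wf : well_founded lt.
Proof.
apply: NNPP => /not_all_ex_not[u0 nacc0].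
have step (x : {u | ~ Acc lt u}) : exists y : {u | ~ Acc lt u}, lt (sval y) (sval x).
  case: x => u nacc; apply: NNPP => nex; apply: (nacc); constructor => v vu.
  by apply: NNPP => naccv; apply: nex; exists (exist _ v naccv).
have [next nextP] := IndefiniteDescription.functional_choice _ step.
pose s k := iter k next (exist _ u0 nacc0).
have desc i j : (i < j)%N -> lt (sval (s j)) (sval (s i)).
  move: i j; apply: (@homo_ltn _ s (fun x y => lt (sval y) (sval x))) => [y x z xy yz|i].
    exact: mo_trans yz xy.
  exact: nextP.
have [i [j [ij le_ij]]] := dickson (fun k => sval (s k)).
by have := mo_lem le_ij; rewrite desc.
Qed.

End MonomialOrder.

(** * Closure properties of generated ideals *)

Section IdealGen.
Variable K : comNzRingType.

Lemma ideal_gen_ind (P Q : K -> Prop) :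
  Q 0 -> (forall a b, Q a -> Q b -> Q (a + b)) ->
  (forall a p, P p -> Q (a * p)) -> forall f, ideal_gen P f -> Q f.
Proof.
move=> Q0 QD QM f [s sP ->]; elim: s sP => [|p s IHs] sP; first by rewrite big_nil.
rewrite big_cons; apply: QD; first by apply/QM/sP; rewrite mem_head.
by apply: IHs => q qs; apply: sP; rewrite inE qs orbT.
Qed.

Lemma ideal_gen0 (P : K -> Prop) : ideal_gen P 0.
Proof. by exists [::] => //; rewrite big_nil. Qed.

Lemma ideal_genD (P : K -> Prop) a b :
  ideal_gen P a -> ideal_gen P b -> ideal_gen P (a + b).
Proof.
move=> [s sP ->] [s' s'P ->]; exists (s ++ s'); last by rewrite big_cat.
by move=> p; rewrite mem_cat => /orP[/sP|/s'P].
Qed.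

Lemma ideal_genM (P : K -> Prop) a b : ideal_gen P b -> ideal_gen P (a * b).
Proof.
move=> [s sP ->]; exists [seq (a * p.1, p.2) | p <- s].
  by move=> _ /mapP[p ps ->] /=; apply: sP.
by rewrite big_map mulr_sumr; apply: eq_bigr => p _; rewrite mulrA.
Qed.

Lemma ideal_genN (P : K -> Prop) a : ideal_gen P a -> ideal_gen P (- a).
Proof. by rewrite -mulN1r; apply: ideal_genM. Qed.

Lemma ideal_gen_gen (P : K -> Prop) a : P a -> ideal_gen P a.
Proof.
move=> Pa; exists [:: (1, a)]; last by rewrite big_seq1 mul1r.
by move=> p; rewrite inE => /eqP ->.
Qed.

Lemma ideal_gen_sum (P : K -> Prop) (T : eqType) (r : seq T) (F : T -> K) :
  (forall i, i \in r -> ideal_gen P (F i)) -> ideal_gen P (\sum_(i <- r) F i).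
Proof.
move=> H; rewrite big_seq; apply: (big_ind (ideal_gen P)) => //.
  exact: ideal_gen0.
exact: ideal_genD.
Qed.

Lemma ideal_gen_sub (P Q : K -> Prop) :
  (forall a, P a -> ideal_gen Q a) -> forall a, ideal_gen P a -> ideal_gen Q a.
Proof.
move=> PQ; apply: (@ideal_gen_ind P (ideal_gen Q)); first exact: ideal_gen0.
  exact: ideal_genD.
by move=> a p /PQ; apply: ideal_genM.
Qed.

End IdealGen.

Lemma ideal_gen_morph (K K' : comNzRingType) (f : {rmorphism K -> K'})
    (P : K -> Prop) (Q : K' -> Prop) :
  (forall a, P a -> ideal_gen Q (f a)) -> forall a, ideal_gen P a -> ideal_gen Q (f a).
Proof.
move=> PQ; apply: (@ideal_gen_ind _ P (fun a => ideal_gen Q (f a))).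
  by rewrite rmorph0; exact: ideal_gen0.
  by move=> a b; rewrite rmorphD; exact: ideal_genD.
by move=> a p /PQ; rewrite rmorphM; apply: ideal_genM.
Qed.

(** * Leading terms, reduction steps and Gröbner bases *)

Section LeadingTerms.
Variables (N : nat) (K : comNzRingType) (lt : rel 'X_{1..N}).
Hypothesis hlt : monomial_order lt.
Implicit Types (f p : {mpoly K[N]}) (u v w : 'X_{1..N}) (F : seq {mpoly K[N]}).

Lemma LM_P f :
  (f != 0 -> LM lt f \in msupp f) /\
  forall u, u \in msupp f -> (u == LM lt f) || lt u (LM lt f).
Proof.
pose mx := foldr (fun u acc => if lt acc u then u else acc) 0%MM.
have max s u : u \in s -> (u == mx s) || lt u (mx s).
  elim: s => //= v s IHs; rewrite inE => /orP[/eqP ->|/IHs us].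
    have := mo_total hlt v (mx s); case: ifP => [|_]; first by rewrite eqxx.
    by rewrite orbF.
  case: ifP => // lt_v; case/orP: us => [/eqP ->|us]; first by rewrite lt_v orbT.
  by rewrite (mo_trans hlt us lt_v) orbT.
have mem s : mx s \in 0%MM :: s.
  elim: s => [|v s IHs] /=; first exact: mem_head.
  case: ifP => _; first by rewrite !inE eqxx orbT.
  by move: IHs; rewrite !inE => /orP[->//|->]; rewrite !orbT.
split=> [fnz|]; last exact: max.
(* The doubtful case is a fold returning its default [0%MM]. Maximality then puts every support
   monomial at or below [0%MM], the least one, so [0%MM] itself lies in the nonempty support. *)
move: (mem (msupp f)); rewrite inE -/(LM lt f) => /orP[/eqP LM0|//].
move: fnz; rewrite -msupp_eq0; case E: (msupp f) => [//|v s] _.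
have := max (msupp f) v; rewrite E mem_head -E -/(LM lt f) LM0 => /(_ isT).
have le0v : (0 <= v)%MM by apply/mnm_lepP => i; rewrite mnm0E.
by rewrite (mo_lem hlt le0v) orbF => /eqP v0; rewrite /LM -/mx LM0 -v0 E mem_head.
Qed.

Lemma LM_mem f : f != 0 -> LM lt f \in msupp f. Proof. by case: (LM_P f). Qed.

Lemma LM_max f u : u \in msupp f -> (u == LM lt f) || lt u (LM lt f).
Proof. by case: (LM_P f) => _; apply. Qed.

Lemma LC_neq0 f : f != 0 -> LC lt f != 0.
Proof. by move/LM_mem; rewrite mcoeff_msupp. Qed.

Lemma LM_uniq f u : u \in msupp f ->
  (forall v, v \in msupp f -> (v == u) || lt v u) -> LM lt f = u.
Proof.
move=> uf umax; have fnz : f != 0.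
  by apply: contraTneq uf => ->; rewrite msupp0.
have /orP[/eqP //|] := umax _ (LM_mem fnz).
by have /orP[/eqP //|/(mo_asym hlt) ->] := LM_max uf.
Qed.

Lemma mcoeff_notlt_LM f w : ~~ lt w (LM lt f) ->
  f@_w = if w == LM lt f then LC lt f else 0.
Proof.
case: eqP => [->//|/eqP wLM] nlt; apply: memN_msupp_eq0.
by apply/negP => /LM_max; rewrite (negPf wLM) (negPf nlt).
Qed.

Lemma mcoeffXM u p w :
  ('X_[u] * p)@_w = if (u <= w)%MM then p@_(w - u)%MM else 0.
Proof.
rewrite mulrC; case: ifP => [uw|nuw]; first by rewrite -{1}(submK uw) addmC mcoeffMX.
apply: memN_msupp_eq0; rewrite (perm_mem (msuppMX _ _)).
by apply/mapP => -[v _ w_def]; rewrite w_def lem_addr in nuw.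
Qed.

Lemma mcoeff_notlt_XM u p w : ~~ lt w (u + LM lt p)%MM ->
  ('X_[u] * p)@_w = if w == (u + LM lt p)%MM then LC lt p else 0.
Proof.
rewrite mcoeffXM; case: ifP => [uw|nuw nlt]; last first.
  by case: eqP => // w_def; rewrite w_def lem_addr in nuw.
rewrite -{1 3}(submK uw) addmC (mo_add2l hlt) => /mcoeff_notlt_LM ->.
by rewrite -(eqm_add2l u) [(u + (_ - _))%MM]addmC submK.
Qed.

Lemma mcoeffM_LT (q p : {mpoly K[N]}) u :
  (q * LT lt p)@_u =
    if (LM lt p <= u)%MM then q@_(u - LM lt p)%MM * LC lt p else 0.
Proof.
rewrite /LT -scalerAr mcoeffZ [q * _]mulrC mcoeffXM.
by case: ifP => _; rewrite ?mulr0 // mulrC.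
Qed.

(** No summand has a monomial above [LM lt f], and the equation on leading coefficients cancels the
    one at [LM lt f]. This descent makes reduction terminate. *)
Lemma reduction_lt (s : seq (K * 'X_{1..N} * {mpoly K[N]})) f :
  (forall c u p, (c, u, p) \in s -> LM lt f = (u + LM lt p)%MM) ->
  LC lt f = \sum_(q <- s) q.1.1 * LC lt q.2 ->
  forall w, w \in msupp (f - \sum_(q <- s) q.1.1 *: ('X_[q.1.2] * q.2)) ->
    lt w (LM lt f).
Proof.
move=> sLM sLC w; apply: contraTT => nlt.
rewrite mcoeff_msupp negbK mcoeffB raddf_sum /= mcoeff_notlt_LM //.
rewrite big_seq (eq_bigr (fun q => if w == LM lt f then q.1.1 * LC lt q.2 else 0)).
  by rewrite -big_seq; case: (w =P LM lt f) => _; rewrite ?big1_eq ?sLC subrr eqxx.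
case=> [[c u] p] /= /sLM Ef; rewrite mcoeffZ mcoeff_notlt_XM -?Ef //.
by case: eqP; rewrite ?mulr0.
Qed.

(** Reading one coefficient turns membership in an ideal of leading terms into a linear equation
    over [K]: at [w], a product [a * LT lt p] contributes [LC lt p] times the coefficient of [a] at
    [w - LM lt p], and nothing if [LM lt p] does not divide [w]. *)
Lemma ideal_gen_LT_coef (P : {mpoly K[N]} -> Prop) t w :
  ideal_gen (LT_set lt P) t ->
  exists2 s : seq (K * 'X_{1..N} * {mpoly K[N]}),
    forall c u p, (c, u, p) \in s -> [/\ P p, c != 0 & w = (u + LM lt p)%MM]
  & t@_w = \sum_(q <- s) q.1.1 * LC lt q.2.
Proof.
move: t; apply: ideal_gen_ind => [|a b [s sP Ea] [s' s'P Eb]|a _ [p [Pp _ ->]]].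
- by exists [::]; rewrite ?mcoeff0 ?big_nil.
- exists (s ++ s'); last by rewrite mcoeffD Ea Eb big_cat.
  by move=> c u p; rewrite mem_cat => /orP[/sP|/s'P].
rewrite mcoeffM_LT; case: ifP => [le_pw|_]; last by exists [::]; rewrite ?big_nil.
(* Reduction steps admit only nonzero coefficients, so zero contributions are dropped from the
   list. *)
have [->|anz] := eqVneq a@_(w - LM lt p)%MM 0.
  by exists [::]; rewrite ?big_nil ?mul0r.
exists [:: (a@_(w - LM lt p)%MM, (w - LM lt p)%MM, p)]; last by rewrite big_seq1.
by move=> c u q; rewrite inE => /eqP[-> -> ->]; rewrite submK.
Qed.

Lemma grobner_decomp (J : {mpoly K[N]} -> Prop) F f :
  is_grobner lt J F -> J f -> f != 0 ->
  exists2 s : seq (K * 'X_{1..N} * {mpoly K[N]}),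
    forall c u p, (c, u, p) \in s ->
      [/\ p \in F, c != 0 & LM lt f = (u + LM lt p)%MM]
  & LC lt f = \sum_(q <- s) q.1.1 * LC lt q.2.
Proof.
move=> [_ gb] Jf fnz.
have /gb/(ideal_gen_LT_coef (LM lt f)) [s sP Es] : ideal_gen (LT_set lt J) (LT lt f).
  by apply: ideal_gen_gen; exists f.
by exists s => //; rewrite -Es mcoeffZ mcoeffX eqxx mulr1.
Qed.

Lemma decomp_reduces1 F (s : seq (K * 'X_{1..N} * {mpoly K[N]})) f :
  f != 0 ->
  (forall c u p, (c, u, p) \in s ->
     [/\ p \in F, c != 0 & LM lt f = (u + LM lt p)%MM]) ->
  LC lt f = \sum_(q <- s) q.1.1 * LC lt q.2 ->
  exists f', reduces1 lt F f f'.
Proof.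
move=> fnz sP Es; exists (f - \sum_(q <- s) q.1.1 *: ('X_[q.1.2] * q.2)).
split=> //; exists s; split=> //; rewrite /LT Es scaler_suml.
rewrite big_seq [RHS]big_seq; apply: eq_bigr => -[[c u] p] /= /sP[_ _ ->].
by rewrite -scalerAr -mpolyXD scalerA.
Qed.

End LeadingTerms.

(** * Exponents split into a [y]-part and an [x]-part *)

Section SplitExponents.
Variables (m n : nat).
Implicit Types (a : 'X_{1..m}) (b : 'X_{1..n}) (u : 'X_{1..m + n}).

Definition yexp u : 'X_{1..m} := [multinom u (lshift n j) | j < m].
Definition xexp u : 'X_{1..n} := [multinom u (rshift m k) | k < n].

Lemma mcat_lshift a b j : mcat a b (lshift n j) = a j.
Proof. by rewrite mnmE (unsplitK (inl j)). Qed.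

Lemma mcat_rshift a b k : mcat a b (rshift m k) = b k.
Proof. by rewrite mnmE (unsplitK (inr k)). Qed.

Lemma mcatK u : mcat (yexp u) (xexp u) = u.
Proof.
apply/mnmP => i; rewrite -(splitK i); case: (split i) => j /=.
  by rewrite mcat_lshift mnmE.
by rewrite mcat_rshift mnmE.
Qed.

Lemma yexp_mcat a b : yexp (mcat a b) = a.
Proof. by apply/mnmP => j; rewrite mnmE mcat_lshift. Qed.

Lemma xexp_mcat a b : xexp (mcat a b) = b.
Proof. by apply/mnmP => j; rewrite mnmE mcat_rshift. Qed.

Lemma eq_mcat a b u : (u == mcat a b) = (yexp u == a) && (xexp u == b).
Proof.
apply/eqP/andP => [->|[/eqP <- /eqP <-]]; last by rewrite mcatK.
by rewrite yexp_mcat xexp_mcat.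
Qed.

Lemma mcatD a b a' b' : mcat (a + a')%MM (b + b')%MM = (mcat a b + mcat a' b')%MM.
Proof.
apply/mnmP => i; rewrite mnmDE -(splitK i); case: (split i) => j /=.
  by rewrite !mcat_lshift mnmDE.
by rewrite !mcat_rshift mnmDE.
Qed.

Lemma mcat0 : mcat 0%MM 0%MM = 0%MM :> 'X_{1..m + n}.
Proof.
apply/mnmP => i; rewrite mnm0E -(splitK i); case: (split i) => j /=.
  by rewrite mcat_lshift mnm0E.
by rewrite mcat_rshift mnm0E.
Qed.

Variable lt : rel 'X_{1..m + n}.
Hypothesis hlt : monomial_order lt.

Lemma restr_x_order : monomial_order (restr_x lt).
Proof.
split=> [b|b b' b''|b b' ne|b ne|b b' b'']; rewrite /restr_x.
- exact: mo_irr.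
- exact: mo_trans.
- have := mo_total hlt (mcat 0%MM b) (mcat 0%MM b').
  by rewrite eq_mcat yexp_mcat xexp_mcat (negPf ne) andbF.
- rewrite mcat0; case: hlt => _ _ _ pos _; apply: pos.
  by rewrite -mcat0 eq_mcat xexp_mcat (negPf ne) andbF.
- by move=> lt_b; rewrite -{1 2}[0%MM]addm0 !mcatD mo_add2r.
Qed.

Lemma restr_y_order : monomial_order (restr_y lt).
Proof.
split=> [b|b b' b''|b b' ne|b ne|b b' b'']; rewrite /restr_y.
- exact: mo_irr.
- exact: mo_trans.
- have := mo_total hlt (mcat b 0%MM) (mcat b' 0%MM).
  by rewrite eq_mcat yexp_mcat xexp_mcat (negPf ne).
- rewrite mcat0; case: hlt => _ _ _ pos _; apply: pos.
  by rewrite -mcat0 eq_mcat yexp_mcat (negPf ne).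
- move=> lt_b; have -> : 0%MM = (0 + 0)%MM :> 'X_{1..n} by rewrite addm0.
  by rewrite !mcatD mo_add2r.
Qed.

End SplitExponents.

(** * The identification of [T] with [Q] and its effect on leading data *)

Section RingIso.
Variables (E : comNzRingType) (m n : nat).

HB.instance Definition _ := GRing.RMorphism.copy (@yT E m n)
  (mmap (@mpolyC (m + n) E) (fun j : 'I_m => 'X_(lshift n j))).

HB.instance Definition _ := GRing.RMorphism.copy (@toT E m n)
  (mmap (@yT E m n) (fun k : 'I_n => 'X_(rshift m k))).

(** The coefficient map is written as a composite so that its ring morphism structure can be
    inferred. *)
HB.instance Definition _ := GRing.RMorphism.copy (@toQ E m n)
  (mmap (@mpolyC n _ \o @mpolyC m E)
     (fun i : 'I_(m + n) =>
        match split i with inl j => ('X_j)%:MP | inr k => 'X_k end)).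

Lemma toQC (c : E) : toQ c%:MP_[m + n] = (c%:MP)%:MP.
Proof. exact: (mmapC _ (@mpolyC n _ \o @mpolyC m E)). Qed.

Lemma toQX u : toQ ('X_[u] : {mpoly E[m + n]}) = ('X_[yexp u])%:MP * 'X_[xexp u].
Proof.
rewrite /toQ (mmapX _ (@mpolyC n _ \o @mpolyC m E)) /mmap1 big_split_ord /=; congr (_ * _).
  rewrite [X in _ = X%:MP]mpolyXE_id rmorph_prod; apply: eq_bigr => j _.
  by rewrite (unsplitK (inl j)) rmorphXn mnmE.
rewrite [RHS]mpolyXE_id; apply: eq_bigr => k _.
by rewrite (unsplitK (inr k)) mnmE.
Qed.

(** [toQ] only regroups terms; injectivity and all comparisons of leading data are read off from
    this formula. *)
Lemma mcoeff_toQ (f : {mpoly E[m + n]}) a b : (toQ f)@_b@_a = f@_(mcat a b).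
Proof.
rewrite [in LHS](mpolyE f) [in RHS](mpolyE f) rmorph_sum !raddf_sum /=.
apply: eq_bigr => u _ /=.
rewrite -mul_mpolyC rmorphM /= toQC toQX mulrA -rmorphM mcoeffCM mcoeffX mcoeffCM.
rewrite mcoeffX eq_mcat mulr_natr mcoeffMn mcoeffCM mcoeffX -mulrnAr.
by case: eqP => _; case: eqP => _; rewrite ?mulr1n ?mulr0n.
Qed.

Lemma toQ_inj : injective (@toQ E m n).
Proof.
move=> f g eq_fg; apply/mpolyP => u.
by rewrite -(mcatK u) -!mcoeff_toQ eq_fg.
Qed.

Lemma toQ_eq0 (f : {mpoly E[m + n]}) : (toQ f == 0) = (f == 0).
Proof. by rewrite -(rmorph0 (@toQ E m n)) (inj_eq toQ_inj). Qed.

Lemma toQ_Xl (j : 'I_m) : toQ ('X_(lshift n j) : {mpoly E[m + n]}) = ('X_j)%:MP.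
Proof.
have yj : yexp U_(lshift n j)%MM = U_(j)%MM.
  by apply/mnmP => k; rewrite mnmE !mnm1E eq_lshift.
have xj : xexp U_(lshift n j)%MM = 0%MM.
  by apply/mnmP => k; rewrite mnmE mnm0E mnm1E eq_lrshift.
by rewrite toQX yj xj mpolyX0 mulr1.
Qed.

Lemma toQ_Xr (k : 'I_n) : toQ ('X_(rshift m k) : {mpoly E[m + n]}) = 'X_k.
Proof.
have yk : yexp U_(rshift m k)%MM = 0%MM.
  by apply/mnmP => j; rewrite mnmE mnm0E mnm1E eq_rlshift.
have xk : xexp U_(rshift m k)%MM = U_(k)%MM.
  by apply/mnmP => j; rewrite mnmE !mnm1E eq_rshift.
by rewrite toQX yk xk mpolyX0 rmorph1 mul1r.
Qed.

Lemma toQ_yT (p : {mpoly E[m]}) : toQ (yT n p) = p%:MP.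
Proof.
rewrite /yT /mmap [in RHS](mpolyE p) !rmorph_sum; apply: eq_bigr => a _.
rewrite -mul_mpolyC (rmorphM (@toQ E m n)) /= [RHS](rmorphM (@mpolyC n _)) /= toQC.
congr (_ * _); rewrite mpolyXE_id /mmap1 !rmorph_prod; apply: eq_bigr => j _.
by rewrite (rmorphXn (@toQ E m n)) /= [RHS](rmorphXn (@mpolyC n _)) toQ_Xl.
Qed.

Lemma toQ_toT (f : {mpoly {mpoly E[m]}[n]}) : toQ (toT f) = f.
Proof.
rewrite /toT /mmap [RHS](mpolyE f) rmorph_sum; apply: eq_bigr => b _.
rewrite -mul_mpolyC (rmorphM (@toQ E m n)) /= toQ_yT; congr (_ * _).
rewrite mpolyXE_id /mmap1 rmorph_prod; apply: eq_bigr => j _.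
by rewrite (rmorphXn (@toQ E m n)) /= toQ_Xr.
Qed.

Variable lt : rel 'X_{1..m + n}.
Hypothesis hlt : elimination_order lt.
Local Notation ltx := (restr_x lt).
Local Notation lty := (restr_y lt).

(** An elimination ordering compares [x]-parts first, so the leading monomial has the largest
    [x]-part and, among the terms sharing it, the largest [y]-part. *)
Lemma LM_toQ (f : {mpoly E[m + n]}) : f != 0 ->
  LM lt f = mcat (LM lty (LC ltx (toQ f))) (LM ltx (toQ f)).
Proof.
case: hlt => mlt elt fnz.
have ox := restr_x_order mlt; have oy := restr_y_order mlt.
have cnz : LC ltx (toQ f) != 0 by apply: LC_neq0; rewrite ?toQ_eq0.
apply: LM_uniq => //.
  by rewrite mcoeff_msupp -mcoeff_toQ -mcoeff_msupp LM_mem.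
move=> u; rewrite -(mcatK u) mcoeff_msupp -mcoeff_toQ => unz.
rewrite elt eq_mcat yexp_mcat xexp_mcat.
have : xexp u \in msupp (toQ f).
  by rewrite mcoeff_msupp; apply: contraNneq unz => ->; rewrite mcoeff0.
case/(LM_max ox)/orP => [/eqP xu|->]; last by rewrite orbT.
rewrite xu eqxx !andbT (mo_irr ox) /=; apply: LM_max => //.
by rewrite mcoeff_msupp /LC -xu.
Qed.

Lemma LC_toQ (f : {mpoly E[m + n]}) : f != 0 ->
  LC lt f = LC lty (LC ltx (toQ f)).
Proof. by move=> fnz; rewrite {1}/LC LM_toQ // -mcoeff_toQ. Qed.

Lemma LM_mpolyC (K : comNzRingType) (p : K) : LM ltx (p%:MP_[n]) = 0%MM.
Proof. by rewrite /LM msuppC; case: (p == 0) => //=; case: ifP. Qed.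

Lemma LM_yT (p : {mpoly E[m]}) : p != 0 -> LM lt (yT n p) = mcat (LM lty p) 0%MM.
Proof.
move=> pnz; rewrite LM_toQ; last by rewrite -toQ_eq0 toQ_yT mpolyC_eq0.
by rewrite toQ_yT /LC LM_mpolyC mcoeffC eqxx mulr1.
Qed.

Lemma LC_yT (p : {mpoly E[m]}) : p != 0 -> LC lt (yT n p) = LC lty p.
Proof. by move=> pnz; rewrite /LC LM_yT // -mcoeff_toQ toQ_yT mcoeffC eqxx mulr1. Qed.

End RingIso.

(** * An invariant of the Gröbner basis algorithm *)

Section Algorithm.
Variables (N : nat) (K : comNzRingType) (lt : rel 'X_{1..N}).

Lemma minimal_wrt_sub (F F' : seq {mpoly K[N]}) f :
  {subset F <= F'} -> minimal_wrt lt F' f -> minimal_wrt lt F f.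
Proof.
move=> sFF' [fnz min]; split=> // -[f' [_ [s [sP LTs Ef']]]].
apply: min; exists f'; split=> //; exists s; split=> // c u p /sP[pF cnz E].
by split=> //; exact: sFF'.
Qed.

Definition input_or_minimal (S : seq {mpoly K[N]}) (g : {mpoly K[N]}) : Prop :=
  g \in S \/ minimal_wrt lt S g.

(** The current set only grows, so it keeps containing [S]; an element minimal with respect to it is
    then minimal with respect to [S]. *)
Lemma gb_pass_minimal S H B (H1 H2 : seq {mpoly K[N]}) :
  gb_pass (H := H) lt B H1 H2 ->
  {subset S <= H1} /\ (forall g, g \in H1 -> input_or_minimal S g) ->
  {subset S <= H2} /\ (forall g, g \in H2 -> input_or_minimal S g).
Proof.
elim=> // h' B' r H1' H2' _ min _ IH [sS H1P]; apply: IH; split.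
  by move=> g /sS gH; rewrite mem_rcons inE gH orbT.
move=> g; rewrite mem_rcons inE => /orP[/eqP ->|/H1P //].
by right; apply: minimal_wrt_sub min.
Qed.

Lemma gb_loop_minimal S (H H' out : seq {mpoly K[N]}) :
  gb_loop lt H H' out ->
  {subset S <= H'} -> (forall g, g \in H' -> input_or_minimal S g) ->
  forall g, g \in out -> input_or_minimal S g.
Proof.
elim=> [H1 H2 eqH _ HP g|H1 H2 H3 B o _ _ _ pass _ IH sS HP].
  by rewrite -eqH; exact: HP.
by have [] := gb_pass_minimal pass (conj sS HP); exact: IH.
Qed.

Lemma gb_algorithm_minimal S (out : seq {mpoly K[N]}) :
  gb_algorithm lt S out -> forall g, g \in out ->
  g \in S \/ minimal_wrt lt [seq f <- S | f != 0] g.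
Proof.
move=> alg g gout.
have [|||] := @gb_loop_minimal [seq f <- S | f != 0] _ _ _ alg _ _ _ gout.
- by move=> f; rewrite mem_undup.
- by move=> f; rewrite mem_undup; left.
- by rewrite mem_filter => /andP[_]; left.
- by right.
Qed.

End Algorithm.

(** * Correctness of the membership test *)

Section GrobnerMembership.
Variables (E : comNzRingType) (N : nat) (ls : lin_solver E) (lt : rel 'X_{1..N}).
Variables (I : idealr {mpoly E[N]}) (F : seq {mpoly E[N]}).
Hypotheses (hlt : monomial_order lt) (hF : is_grobner lt (fun p => p \in I) F).

Lemma dot0 k (l : 'rV[E]_k) : dot l 0 = 0.
Proof. by rewrite /dot big1 // => i _; rewrite mxE mulr0. Qed.

Lemma dotD k (l v v' : 'rV[E]_k) : dot l (v + v') = dot l v + dot l v'.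
Proof. by rewrite /dot -big_split; apply: eq_bigr => i _; rewrite mxE mulrDr. Qed.

Lemma dot_delta k (l : 'rV[E]_k) c i : dot l (c *: delta_mx 0 i) = c * l 0 i.
Proof.
rewrite /dot (bigD1 i) //= big1 ?addr0 => [|j /negPf ji]; rewrite !mxE !eqxx.
  by rewrite mulr1 mulrC.
by rewrite ji !mulr0.
Qed.

Lemma reduce_step_some f f' : reduce_step ls lt F f = Some f' ->
  (f' \in I) = (f \in I) /\ forall w, w \in msupp f' -> lt w (LM lt f).
Proof.
rewrite /reduce_step; set D := [seq p <- F | _].
set row_D := (\row_i _); have := ls_memP ls (LC lt f) row_D.
case: (ls_mem _ _ _) => // v LCf [<-].
have memD i : (i < size D)%N -> D`_i \in F /\ (LM lt D`_i <= LM lt f)%MM.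
  by move=> /(mem_nth 0); rewrite mem_filter => /andP[].
split.
  rewrite rpredBr //; apply: rpred_sum => i _; rewrite -mul_mpolyC mulrA.
  by apply: idealMr; apply: (hF.1 _ (memD _ (ltn_ord i)).1).2.
pose s := [seq (v 0 i, (LM lt f - LM lt D`_i)%MM, D`_i) | i : 'I_(size D) <- index_enum _].
have -> : \sum_(i < size D) v 0 i *: ('X_[(LM lt f - LM lt D`_i)%MM] * D`_i) =
    \sum_(q <- s) q.1.1 *: ('X_[q.1.2] * q.2) by rewrite big_map.
apply: reduction_lt => //.
  by move=> c u p /mapP[i _ [_ -> ->]]; rewrite submK // (memD _ (ltn_ord i)).2.
by rewrite LCf big_map; apply: eq_bigr => i _; rewrite mxE mulrC.
Qed.

(** For a nonzero [f] in [I], the Gröbner property would give a solution of the very linear equation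
    that the solver reports unsolvable. *)
Lemma reduce_step_none f : reduce_step ls lt F f = None -> f != 0 -> f \notin I.
Proof.
rewrite /reduce_step; set D := [seq p <- F | _].
set row_D := (\row_i _); have := ls_memP ls (LC lt f) row_D.
case: (ls_mem _ _ _) => // nosol _ fnz; apply/negP => fI.
have [s sP LCs] := grobner_decomp hF fI fnz.
suff [v Ev] : exists v, LC lt f = dot row_D v by exact: nosol Ev.
(* The list may use the same [p] several times, so the vector is built by adding each [c] at the
   index of [p] in [D]. *)
rewrite {}LCs; elim: s sP => [|[[c u] p] s IHs] sP.
  by exists 0; rewrite big_nil dot0.
have [|v Ev] := IHs; first by move=> c' u' p' qs; apply: sP; rewrite inE qs orbT.
have [pF _ LMf] := sP c u p (mem_head _ _).
have pD : p \in D by rewrite mem_filter pF LMf lem_addl.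
have iD : (index p D < size D)%N by rewrite index_mem.
exists (c *: delta_mx 0 (Ordinal iD) + v).
by rewrite big_cons dotD -Ev dot_delta mxE /= nth_index.
Qed.

(** Well-founded induction on the leading monomial: a step preserves membership in [I] and lowers
    that monomial, at the cost of one unit of fuel. *)
Lemma grobner_mem_correct f : exists k0, forall k, (k0 <= k)%N ->
  grobner_mem ls lt F k f = Some (f \in I).
Proof.
have mem0 k : grobner_mem ls lt F k 0 = Some (0 \in I).
  by case: k => [|k]; rewrite /= eqxx rpred0.
have [u fu] : exists u, forall w, w \in msupp f -> (w == u) || lt w u.
  by exists (LM lt f) => w; exact: LM_max.
have [->|fnz] := eqVneq f 0; first by exists 0%N.
move: {u fu} (LM lt f) {-2}f (erefl (LM lt f)) fnz => u {}f.
elim/(well_founded_ind (mo_wf hlt)): u f => u IHu f LMf fnz.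
case Ef: (reduce_step ls lt F f) => [f'|]; last first.
  (* Discovering that no step exists also consumes one unit of fuel. *)
  by exists 1%N => -[//|k] _; rewrite /= (negPf fnz) Ef (negPf (reduce_step_none Ef fnz)).
have [f'I f'lt] := reduce_step_some Ef.
suff [k0 k0P] : exists k0, forall k, (k0 <= k)%N ->
    grobner_mem ls lt F k f' = Some (f' \in I).
  by exists k0.+1 => -[//|k] kk0; rewrite /= (negPf fnz) Ef k0P // f'I.
have [->|f'nz] := eqVneq f' 0; first by exists 0%N.
by apply: (IHu (LM lt f')) => //; rewrite -LMf; apply: f'lt; apply: LM_mem.
Qed.

End GrobnerMembership.

(** * Sorting the terms of a polynomial by their coefficients *)

Section FilterCoefs.
Variables (K : comNzRingType) (n : nat).

Definition filter_coefs (P : pred K) (q : {mpoly K[n]}) : {mpoly K[n]} :=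
  \sum_(u <- msupp q | P q@_u) q@_u *: 'X_[u].

Lemma mcoeff_filter_coefs P q u :
  (filter_coefs P q)@_u = if P q@_u then q@_u else 0.
Proof.
rewrite /filter_coefs raddf_sum /=.
under eq_bigr do rewrite mcoeffZ mcoeffX.
have [uq|/memN_msupp_eq0 qu0] := boolP (u \in msupp q); last first.
  rewrite big1_seq ?qu0 ?if_same // => v _.
  by case: eqP => [->|_]; rewrite ?qu0 ?mul0r ?mulr0.
rewrite big_mkcond (bigD1_seq u) //= eqxx mulr1 big1 ?addr0 // => v /negPf vu.
by rewrite vu mulr0 if_same.
Qed.

Lemma filter_coefs_split P q :
  q = filter_coefs (predC P) q + filter_coefs P q.
Proof.
by apply/mpolyP => u; rewrite mcoeffD !mcoeff_filter_coefs /=; case: (P _); rewrite ?add0r ?addr0.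
Qed.

Lemma filter_coefsP P q u : u \in msupp (filter_coefs P q) -> P (filter_coefs P q)@_u.
Proof.
rewrite mcoeff_msupp mcoeff_filter_coefs.
by case: ifP => [//|_]; rewrite eqxx.
Qed.

Lemma mcoeff_lift_coefs (K' : comNzRingType) (f : {mpoly K'[n]}) (h : 'X_{1..n} -> K) u :
  (lift_coefs f h)@_u = if u \in msupp f then h u else 0.
Proof.
rewrite /lift_coefs raddf_sum /=; under eq_bigr do rewrite mcoeffZ mcoeffX.
have [uf|nuf] := boolP (u \in msupp f); last first.
  rewrite big1_seq // => v /andP[_ vf].
  by case: eqP vf nuf => [-> ->//|]; rewrite mulr0.
by rewrite (bigD1_seq u) //= eqxx mulr1 big1 ?addr0 // => v /negPf ->; rewrite mulr0.
Qed.

End FilterCoefs.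

(** Finitely many coefficients are tested, so the maximum of their fuel bounds suffices. *)
Lemma split_coefs_correct (E : comNzRingType) m n (ls : lin_solver E)
    (lt : rel 'X_{1..m}) (F : seq {mpoly E[m]}) (I : idealr {mpoly E[m]})
    (g : {mpoly {mpoly E[m]}[n]}) :
  monomial_order lt -> is_grobner lt (fun p => p \in I) F ->
  exists k0, forall k, (k0 <= k)%N -> split_coefs ls lt F k g =
    Some (filter_coefs [predC I] g, filter_coefs [in I] g).
Proof.
move=> hlt hF; rewrite /split_coefs /filter_coefs.
elim: (msupp g) => [|u s [k0 k0P]]; first by exists 0%N => k _; rewrite !big_nil.
have [k1 k1P] := grobner_mem_correct ls hlt hF g@_u.
exists (maxn k0 k1) => k; rewrite geq_max => /andP[/k0P /= -> /k1P ->].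
by rewrite !big_cons; case: (g@_u \in I); rewrite /= addrC.
Qed.

(** * The epimorphism [phi] onto polynomials over the quotient *)

Section Quotient.
Variables (E : comNzRingType) (m n : nat) (I : idealr {mpoly E[m]}).
Local Notation piI := (\pi_({ideal_quot I})%qT : {mpoly E[m]} -> {ideal_quot I}).

HB.instance Definition _ := GRing.RMorphism.copy (@phi E m n I) (map_mpoly piI).

Lemma pi_eq0 (p : {mpoly E[m]}) : (piI p == 0) = (p \in I).
Proof. by rewrite -[p in RHS]subr0 Quotient.idealrBE rmorph0. Qed.

Lemma mcoeff_phi (q : {mpoly {mpoly E[m]}[n]}) u : (phi I q)@_u = piI q@_u.
Proof. exact: mcoeff_map_mpoly. Qed.

Lemma phiE (q : {mpoly {mpoly E[m]}[n]}) :
  phi I q = \sum_(u <- msupp q) piI q@_u *: 'X_[u].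
Proof.
by apply: eq_bigr => u _; rewrite mmap1_id -mul_mpolyC.
Qed.

Lemma mem_msupp_phi (q : {mpoly {mpoly E[m]}[n]}) u :
  (u \in msupp (phi I q)) = (q@_u \notin I).
Proof. by rewrite mcoeff_msupp mcoeff_phi pi_eq0. Qed.

Lemma phi_eq0 (q : {mpoly {mpoly E[m]}[n]}) : (forall u, q@_u \in I) -> phi I q = 0.
Proof.
by move=> qI; apply/mpolyP => u; apply/eqP; rewrite mcoeff_phi mcoeff0 pi_eq0.
Qed.

Lemma phiC (p : {mpoly E[m]}) : p \in I -> phi I (p%:MP_[n]) = 0.
Proof.
by move=> pI; apply: phi_eq0 => u; rewrite mcoeffC mulr_natr rpredMn.
Qed.

Lemma phi_lift_coefs (f : {mpoly {ideal_quot I}[n]}) (h : 'X_{1..n} -> {mpoly E[m]}) :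
  (forall u, u \in msupp f -> piI (h u) = f@_u) -> phi I (lift_coefs f h) = f.
Proof.
move=> hP; apply/mpolyP => u; rewrite mcoeff_phi mcoeff_lift_coefs.
by case: ifPn => [/hP //|/memN_msupp_eq0 ->]; rewrite rmorph0.
Qed.

Lemma phi_surj (f : {mpoly {ideal_quot I}[n]}) : exists q, phi I q = f.
Proof.
by exists (lift_coefs f (fun u => repr f@_u)); apply: phi_lift_coefs => u _; exact: reprK.
Qed.

Lemma ideal_gen_phi (P : {mpoly {mpoly E[m]}[n]} -> Prop)
    (Q : {mpoly {ideal_quot I}[n]} -> Prop) :
  (forall q, P q -> ideal_gen Q (phi I q)) ->
  forall q, ideal_gen P q -> ideal_gen Q (phi I q).
Proof.
pose phi_morph : {rmorphism {mpoly {mpoly E[m]}[n]} -> {mpoly {ideal_quot I}[n]}} :=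
  @phi E m n I.
exact: (ideal_gen_morph (f := phi_morph)).
Qed.

Variable lt : rel 'X_{1..n}.
Hypothesis hlt : monomial_order lt.

(** [phi] can only delete monomials, and the leading one survives because its coefficient is nonzero
    modulo [I]. *)
Lemma LT_phi (q : {mpoly {mpoly E[m]}[n]}) : LC lt q \notin I ->
  [/\ phi I q != 0, LT lt (phi I q) = phi I (LT lt q) & LM lt (phi I q) = LM lt q].
Proof.
move=> LCq; have memLM : LM lt q \in msupp (phi I q) by rewrite mem_msupp_phi.
have LMphi : LM lt (phi I q) = LM lt q.
  apply: LM_uniq => // v; rewrite mem_msupp_phi => vq; apply: LM_max => //.
  by rewrite mcoeff_msupp; apply: contraNneq vq => ->; rewrite rpred0.
split=> //; first by apply: contraTneq memLM => ->; rewrite msupp0.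
rewrite /LT LMphi /LC LMphi mcoeff_phi; apply/mpolyP => u.
rewrite mcoeff_phi !mcoeffZ !mcoeffX rmorphM /=.
by case: eqP => _; rewrite ?rmorph1 ?rmorph0.
Qed.

End Quotient.

(** * Consequences of the elimination ordering for [x]-leading terms *)

Section EliminationBasis.
Variables (E : comNzRingType) (m n : nat) (lt : rel 'X_{1..m + n}).
Hypothesis hlt : elimination_order lt.
Local Notation ltx := (restr_x lt).
Local Notation lty := (restr_y lt).
Local Notation T := {mpoly E[m + n]}.

Lemma minimal_LC_notin (I : idealr {mpoly E[m]}) (nu : seq {mpoly E[m]}) (F : seq T) g :
  is_grobner lty (fun p => p \in I) nu ->
  {subset [seq yT n p | p <- nu] <= F} -> minimal_wrt lt F g ->
  LC ltx (toQ g) \notin I.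
Proof.
move=> gb nuF [gnz min]; apply/negP => LCI; apply: min.
have ox := restr_x_order hlt.1; have oy := restr_y_order hlt.1.
have cnz : LC ltx (toQ g) != 0 by apply: LC_neq0; rewrite ?toQ_eq0.
have [s sP LCs] := grobner_decomp gb LCI cnz.
(* Multiplying each [y]-monomial by the leading [x]-monomial of [g] turns the decomposition of the
   [x]-leading coefficient over [nu] into a reduction step for [g]. *)
pose s' := [seq (q.1.1, mcat q.1.2 (LM ltx (toQ g)), yT n q.2) | q <- s].
have nuN0 p : p \in nu -> p != 0 by case/gb.1.
apply: (@decomp_reduces1 _ _ _ _ s') => //.
  move=> c u p /mapP[[[c' u'] p'] /sP[p'nu c'nz LMc] [-> -> ->]]; split=> //.
    exact/nuF/map_f.
  by rewrite LM_toQ // LMc LM_yT ?nuN0 //= -mcatD addm0.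
rewrite LC_toQ // LCs big_map big_seq [RHS]big_seq.
by apply: eq_bigr => -[[c u] p] /sP[pnu _ _] /=; rewrite LC_yT // nuN0.
Qed.

(* Each reduction step contributes a multiple of some LT_x(g) to the coefficient
   at the leading x-monomial; divide until that coefficient is exhausted. *)
Lemma grobner_LT_x (J : T -> Prop) (gs : seq T) f :
  is_ideal J -> is_grobner lt J gs -> J f ->
  ideal_gen (LT_set ltx (fun q => exists2 g, g \in gs & q = toQ g)) (LT ltx (toQ f)).
Proof.
move=> [_ JD JM] gb Jf; rewrite /LT /LC.
have ox := restr_x_order hlt.1.
have : forall v, v \in msupp (toQ f) -> (v == LM ltx (toQ f)) || ltx v (LM ltx (toQ f)).
  by move=> v; exact: LM_max.
(* From here [b] is fixed and only bounds the [x]-monomials of [f]: during the division the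
   coefficient at [b] may vanish while [f] does not. *)
move: (LM ltx (toQ f)) => b.
have [->|fnz] := eqVneq f 0.
  by move=> _; rewrite rmorph0 mcoeff0 scale0r; exact: ideal_gen0.
move: (LM lt f) {-2}f (erefl (LM lt f)) fnz Jf => w {}f.
elim/(well_founded_ind (mo_wf hlt.1)): w f => w IHw f LMf fnz Jf fb.
have [s sP LCs] := grobner_decomp gb Jf fnz.
pose red := \sum_(q <- s) q.1.1 *: ('X_[q.1.2] * q.2).
have f'lt : forall v, v \in msupp (f - red) -> lt v (LM lt f).
  by apply: (reduction_lt hlt.1) => // c u p /sP[].
have LMfb : (xexp (LM lt f) == b) || ltx (xexp (LM lt f)) b.
  rewrite LM_toQ // xexp_mcat; apply/fb/LM_mem => //.
  by rewrite toQ_eq0.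
have f'b v : v \in msupp (toQ (f - red)) -> (v == b) || ltx v b.
  move=> vf'; have : mcat (LM lty (toQ (f - red))@_v) v \in msupp (f - red).
    rewrite mcoeff_msupp -mcoeff_toQ -mcoeff_msupp; apply: LM_mem.
      exact: restr_y_order hlt.1.
    by rewrite -mcoeff_msupp.
  move/f'lt; rewrite -(mcatK (LM lt f)) hlt.2.
  case/orP => [lt_v|/andP[/eqP -> _]]; last exact: LMfb.
  case/orP: LMfb => [/eqP <-|]; first by rewrite lt_v orbT.
  by move/(mo_trans ox lt_v) ->; rewrite orbT.
have -> : toQ f = toQ (f - red) + toQ red by rewrite -rmorphD subrK.
rewrite mcoeffD scalerDl; apply: ideal_genD.
  have [->|f'nz] := eqVneq (f - red) 0.
    by rewrite rmorph0 mcoeff0 scale0r; exact: ideal_gen0.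
  apply: (IHw (LM lt (f - red))) => //.
    by rewrite -LMf; apply/f'lt/LM_mem => //; exact: hlt.1.
  apply: (JD) => //; rewrite -mulN1r; apply: (JM).
  have J0 : J 0 by rewrite -(mul0r f); exact: JM.
  rewrite /red big_seq; apply: (big_ind J) => // -[[c u] p] /sP[pgs _ _] /=.
  by rewrite -mul_mpolyC; do 2!apply: (JM); exact: (gb.1 _ pgs).2.
rewrite /red rmorph_sum raddf_sum /= scaler_suml; apply: ideal_gen_sum.
move=> [[c u] p] /sP[pgs _ LMup] /=.
have pnz : p != 0 by case: (gb.1 _ pgs).
have LMx : xexp (LM lt f) = (xexp u + LM ltx (toQ p))%MM.
  by rewrite LMup -{1}(mcatK u) (LM_toQ hlt pnz) -mcatD xexp_mcat.
(* Since [b] is not below the leading [x]-monomial of this summand, the coefficient at [b] is either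
   zero or a multiple of [LC ltx (toQ p)]. *)
have notlt : ~~ ltx b (xexp u + LM ltx (toQ p))%MM.
  rewrite -LMx; case/orP: LMfb => [/eqP ->|]; first by rewrite mo_irr.
  by move/(mo_asym ox) ->.
rewrite -[c *: _]mul_mpolyC !rmorphM /= toQC toQX mulrA -!mulrA !mcoeffCM.
rewrite (mcoeff_notlt_XM ox notlt).
case: eqP => [b_def|_]; last by rewrite !mulr0 scale0r; exact: ideal_gen0.
rewrite {1}b_def mpolyXD mulrA -scalerA -mul_mpolyC scalerAr.
do 2!apply: ideal_genM.
apply: ideal_gen_gen; exists (toQ p); split => //; first by exists p.
by rewrite toQ_eq0.
Qed.

End EliminationBasis.

(** * Assembly of parts (i), (ii) and (iii) *)

Theorem theorem4p4
  (E : comNzRingType) (hE : noetherian E) (ls : lin_solver E) (m n : nat)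
  (nu : seq {mpoly E[m]}) (I : idealr {mpoly E[m]})
  (hI : forall p, p \in I <-> ideal_gen (fun q => q \in nu) p)
  (t : nat) (fbar : 'I_t -> {mpoly {ideal_quot I}[n]})
  (hfbar : forall i, fbar i != 0)
  (h : 'I_t -> 'X_{1..n} -> {mpoly E[m]})
  (hh : forall i u, u \in msupp (fbar i) ->
     (\pi_({ideal_quot I}) (h i u))%qT = (fbar i)@_u)
  (lt : rel 'X_{1..m + n}) (hlt : elimination_order lt)
  (hnu : is_grobner (restr_y lt) (fun p => p \in I) nu)
  (gs : seq {mpoly E[m + n]}) :
  let Jbar := ideal_gen (fun f => f \in codom fbar) in
  let G := [seq yT n p | p <- nu] in
  let S := codom (fun i => toT (lift_coefs (fbar i) (h i))) ++ G in
  let J := ideal_gen (fun f => f \in S) in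
  is_grobner lt J gs ->
  gb_algorithm lt S gs ->
  let ltx := restr_x lt in
  let gsbar := [seq phi I (toQ g) | g <- gs & g \notin G] in
  [/\ (* (i) *)
      forall g, g \in gs -> g \notin G ->
        [/\ phi I (toQ g) != 0,
            LT ltx (phi I (toQ g)) = phi I (LT ltx (toQ g))
          & LM ltx (phi I (toQ g)) = LM ltx (toQ g)],
      (* (ii) *)
      gsbar =i [seq f <- [seq phi I (toQ g) | g <- gs] | f != 0] /\
      is_grobner ltx Jbar gsbar
    & (* (iii) *)
      forall g, g \in gs -> g \notin G ->
        exists g' g'' : {mpoly {mpoly E[m]}[n]},
          [/\ toQ g = g' + g'',
              (forall u, u \in msupp g' -> g'@_u \notin I) /\
              (forall u, u \in msupp g'' -> g''@_u \in I),
              exists k0 : nat, forall k, (k0 <= k)%N ->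
                split_coefs ls (restr_y lt) nu k (toQ g) = Some (g', g''),
              phi I (toQ g) = phi I g' /\
              phi I g' = \sum_(u <- msupp g')
                           (\pi_({ideal_quot I}) (g'@_u))%qT *: 'X_[u]
            & forall u, u \in msupp g' ->
                (\pi_({ideal_quot I}) (g'@_u))%qT != 0 :> {ideal_quot I}]].
Proof.
move=> Jbar G S J gbJ alg ltx gsbar.
have ox : monomial_order ltx := restr_x_order hlt.1.
have oy := restr_y_order hlt.1.
have phi_f i : phi I (toQ (toT (lift_coefs (fbar i) (h i)))) = fbar i.
  by rewrite toQ_toT; apply: phi_lift_coefs => u; exact: hh.
have phi_G g : g \in G -> phi I (toQ g) = 0.
  by case/mapP => p /hnu.1[_ pI] ->; rewrite toQ_yT phiC.
have LC_gs g : g \in gs -> g \notin G -> LC ltx (toQ g) \notin I.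
  move=> ggs gG; have gnz : g != 0 by case: (gbJ.1 _ ggs).
  have [|] := gb_algorithm_minimal alg ggs; last first.
    apply: (minimal_LC_notin hlt hnu) => p pG; rewrite mem_filter mem_cat pG orbT andbT.
    case/mapP: pG => p' /hnu.1[p'nz _] ->.
    by rewrite -toQ_eq0 toQ_yT mpolyC_eq0.
  rewrite mem_cat (negPf gG) orbF => /codomP[i g_def].
  have qg : toQ g = lift_coefs (fbar i) (h i) by rewrite g_def toQ_toT.
  have : LM ltx (toQ g) \in msupp (toQ g) by apply: LM_mem; rewrite ?toQ_eq0.
  have phig : phi I (toQ g) = fbar i by rewrite g_def phi_f.
  (* The lift of [fbar i] has no monomial outside the support of [fbar i], where all images of
     coefficients are nonzero. *)
  rewrite /LC -mem_msupp_phi phig; move: (LM ltx _) => u.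
  rewrite qg [_ \in msupp (lift_coefs _ _)]mcoeff_msupp mcoeff_lift_coefs.
  by case: ifP => //; rewrite eqxx.
have i_part g : g \in gs -> g \notin G ->
    [/\ phi I (toQ g) != 0, LT ltx (phi I (toQ g)) = phi I (LT ltx (toQ g))
      & LM ltx (phi I (toQ g)) = LM ltx (toQ g)].
  by move=> ggs gG; apply: LT_phi => //; exact: LC_gs.
split=> // [|g ggs gG]; last first.
  pose g' := filter_coefs [predC I] (toQ g).
  pose g'' := filter_coefs [in I] (toQ g).
  have qg : toQ g = g' + g'' := filter_coefs_split _ _.
  have g'I u : u \in msupp g' -> g'@_u \notin I by apply: filter_coefsP.
  have phi_g'' : phi I g'' = 0.
    by apply: phi_eq0 => u; rewrite mcoeff_filter_coefs; case: ifP => // _; exact: rpred0.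
  exists g', g''; split.
  - exact: qg.
  - by split=> // u; apply: filter_coefsP.
  - exact: split_coefs_correct.
  - by split; [rewrite {1}qg rmorphD /= phi_g'' addr0 | exact: phiE].
  - by move=> u /g'I; rewrite pi_eq0.
split.
  move=> q; rewrite mem_filter; apply/mapP/andP => [[g]|[qnz /mapP[g ggs q_def]]].
    rewrite mem_filter => /andP[gG ggs] ->; split; last exact: map_f.
    by case: (i_part g).
  (* [phi] vanishes on [G], so a nonzero image comes from outside [G]. *)
  exists g => //; rewrite mem_filter ggs andbT; apply: contraNN qnz.
  by rewrite q_def => /phi_G ->.
have phi_J f : J f -> Jbar (phi I (toQ f)).
  apply: (ideal_gen_morph (f := phi I \o @toQ E m n)) => {}f /=.
  rewrite mem_cat => /orP[/codomP[i ->]|/phi_G ->]; last exact: ideal_gen0.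
  by rewrite phi_f; apply: ideal_gen_gen; exact: codom_f.
have gsbar_P q : q \in gsbar -> q != 0 /\ Jbar q.
  case/mapP => g; rewrite mem_filter => /andP[gG ggs] ->; split.
    by case: (i_part g).
  exact/phi_J/(gbJ.1 _ ggs).2.
split=> // q; split; last first.
  apply: ideal_gen_sub => _ [g [/gsbar_P[gnz gJ] _ ->]].
  by apply: ideal_gen_gen; exists g.
apply: ideal_gen_sub => _ [{}q [qJ qnz ->]].
have idJ : is_ideal J.
  by split; [exact: ideal_gen0|exact: ideal_genD|exact: ideal_genM].
(* [J] maps onto [Jbar]: multipliers lift by surjectivity of [phi], and each [fbar i] lifts to its
   chosen representative. *)
have [f Jf q_def] : exists2 f, J f & phi I (toQ f) = q.
  move: {qnz} q qJ; apply: ideal_gen_ind => [|a b [f Jf <-] [g Jg <-]|a _ /codomP[i ->]].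
  - by exists 0; [exact: ideal_gen0|rewrite !rmorph0].
  - by exists (f + g); [exact: ideal_genD|rewrite !rmorphD].
  have [p <-] := phi_surj a.
  exists (toT p * toT (lift_coefs (fbar i) (h i))); last by rewrite !rmorphM /= toQ_toT phi_f.
  by apply/ideal_genM/ideal_gen_gen; rewrite mem_cat codom_f.
(* This lets terms with coefficients in [I] be removed from [f] without leaving [J]. *)
have Jy p : p \in I -> J (yT n p).
  move/hI; apply: (ideal_gen_morph (f := @yT E m n)) => {}p pnu.
  by apply: ideal_gen_gen; rewrite mem_cat map_f ?orbT.
(* Discarding the coefficients in I makes f and q share their leading x-monomial. *)
pose f1 := f - toT (filter_coefs [in I] (toQ f)).
have qf1 : toQ f1 = filter_coefs [predC I] (toQ f).
  by rewrite rmorphB /= toQ_toT {1}(filter_coefs_split [in I] (toQ f)) addrK.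
have Jf1 : J f1.
  apply: ideal_genD => //; apply: ideal_genN; rewrite /filter_coefs rmorph_sum big_mkcond.
  apply: ideal_gen_sum => u _; case: ifP => [uI|_]; last exact: ideal_gen0.
  rewrite -mul_mpolyC rmorphM mulrC; apply: ideal_genM => /=.
  by rewrite /toT mmapC; exact: Jy.
have phi_f1 : phi I (toQ f1) = q.
  rewrite -q_def !rmorphB /= toQ_toT [X in _ - X]phi_eq0 ?subr0 // => u.
  by rewrite mcoeff_filter_coefs; case: ifP => // _; exact: rpred0.
have f1nz : toQ f1 != 0 by apply: contraNneq qnz => f10; rewrite -phi_f1 f10 rmorph0.
have LCf1 : LC ltx (toQ f1) \notin I.
  by rewrite qf1; apply: (@filter_coefsP _ _ [predC I]); rewrite -qf1 LM_mem.
have [_ + _] := LT_phi ox LCf1; rewrite phi_f1 => ->.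
apply: ideal_gen_phi (grobner_LT_x hlt idJ gbJ Jf1) => _ [_ [[g ggs ->] _ ->]].
(* An element of [G] is constant in [x] with value in [I], so [phi] kills its leading term; for the
   others (i) identifies the image with a leading term of [gsbar]. *)
have [gG|gG] := boolP (g \in G).
  case/mapP: gG => p /hnu.1[_ pI] ->; rewrite toQ_yT /LT /LC LM_mpolyC mcoeffC eqxx mulr1.
  by rewrite -mul_mpolyC rmorphM /= phiC // mul0r; exact: ideal_gen0.
have [gnz <- _] := i_part g ggs gG.
apply: ideal_gen_gen; exists (phi I (toQ g)); split=> //.
by apply: map_f; rewrite mem_filter gG.
Qed.
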